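(* Let $C\in S^n$, $b\in\mathbb{R}^m$, and let $\mathcal{A}:S^n\to\mathbb{R}^m$ be a linear operator, such that both the problem $\min_X\{\langle C,X\rangle : \mathcal{A}X=b,\ X\succeq 0\}$ and its Lagrange dual $\max_y\{b^\top y : C-\mathcal{A}^\top y\succeq 0\}$ have optimal solutions. Assume that $C\succ 0$, $b\neq 0$, and there exists $X\succ 0$ such that $\mathcal{A}X=b$. Then both of the problems $$\min_{X\in S^n}\{\kappa(X) : \mathcal{A}X=b\}\qquad\text{and}\qquad \min_{y\in\mathbb{R}^m}\{\kappa^\circ(\mathcal{A}^\top y) : b^\top y\geq 1\}$$ achieve their respective optimum values, and strong duality holds, i.e., $$\Big[\min_X\{\kappa(X) : \mathcal{A}X=b\}\Big]\cdot\Big[\min_y\{\kappa^\circ(\mathcal{A}^\top y) : b^\top y\geq 1\}\Big]=1.$$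
   Context: $S^n$ is the space of real symmetric $n\times n$ matrices with inner product $\langle A,B\rangle=\operatorname{tr}(AB)$; $X\succeq 0$ (resp. $X\succ 0$) means $X$ is positive semidefinite (resp. positive definite). $\mathcal{A}^\top:\mathbb{R}^m\to S^n$ is the adjoint of $\mathcal{A}$. The gauge function $\kappa$ is defined by $\kappa(X)=\langle C,X\rangle$ if $X\succeq 0$ and $\kappa(X)=+\infty$ otherwise. Its polar is $\kappa^\circ(Z)=\inf\{\mu\geq 0 : \mu C-Z\succeq 0\}$ for $Z\in S^n$ (with $\inf\emptyset=+\infty$). *)

(* Defs.v *)
From HB Require Import structures.
From mathcomp Require Import all_boot all_order all_algebra.
From mathcomp Require Import sesquilinear.
From mathcomp Require Import all_classical all_reals ereal.
Set Implicit Arguments.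
Unset Strict Implicit.
Unset Printing Implicit Defensive.
Import Order.TTheory GRing.Theory Num.Theory.
Local Open Scope classical_set_scope.
Local Open Scope ring_scope.

Section SymmetricMatrices.
Context (R : realType) (n : nat).

Record symmx := SymMx {
  mx_of_symmx :> 'M[R]_n;
  _ : mx_of_symmx \is symmetricmx }.

HB.instance Definition _ := [isSub for mx_of_symmx].
HB.instance Definition _ := [Choice of symmx by <:].

Lemma symmetricmxE (M : 'M[R]_n) : (M \is symmetricmx) = (M == M^T).
Proof. by rewrite qualifE /= expr0 scale1r map_mx_id. Qed.

Fact symmetricmx_submod_closed :
  submod_closed (symmetricmx : {pred 'M[R]_n}).
Proof.
split=> [|a M N]; first by rewrite symmetricmxE trmx0.
rewrite !symmetricmxE => /eqP hM /eqP hN.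
by rewrite linearP /= -hM -hN.
Qed.

HB.instance Definition _ := GRing.isSubmodClosed.Build R 'M[R]_n
  (symmetricmx : {pred 'M[R]_n}) symmetricmx_submod_closed.
HB.instance Definition _ := [SubChoice_isSubLmodule of symmx by <:].

Lemma symmx_tr (X : symmx) : (X : 'M[R]_n)^T = X.
Proof. by case: X => M /=; rewrite symmetricmxE => /eqP/esym. Qed.

Fact sympart_subproof (M : 'M[R]_n) :
  2^-1 *: (M + M^T) \is symmetricmx.
Proof. by rewrite symmetricmxE linearZ /= [(M + _)^T]linearD /= trmxK addrC. Qed.

Definition sympart (M : 'M[R]_n) : symmx := SymMx (sympart_subproof M).

Definition innermx (X Y : symmx) : R := \tr ((X : 'M[R]_n) *m Y).

Fact sympart_is_linear : linear sympart.
Proof.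
move=> a M N; apply: val_inj => /=.
rewrite linearP /= scalerA mulrC -scalerA -scalerDr; congr (_ *: _).
by rewrite scalerDr addrACA.
Qed.

HB.instance Definition _ := GRing.isLinear.Build R 'M[R]_n symmx _
  sympart sympart_is_linear.

Lemma symmxK (X : symmx) : sympart X = X.
Proof.
apply: val_inj; rewrite /= symmx_tr -mulr2n -scaler_nat scalerA.
by rewrite mulVf ?scale1r// pnatr_eq0.
Qed.

Lemma innermx_sympart (M : 'M[R]_n) (X : symmx) :
  innermx (sympart M) X = \tr (M *m X).
Proof.
rewrite /innermx /= -scalemxAl mulmxDl linearZ linearD /=.
have -> : \tr (M^T *m X) = \tr (M *m X).
  by rewrite -mxtrace_tr trmx_mul trmxK symmx_tr mxtrace_mulC.
by rewrite mulrDr [2^-1 * _]mulrC -splitr.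
Qed.

Lemma innermx_definite (X : symmx) : innermx X X = 0 -> X = 0.
Proof.
have -> : innermx X X = \sum_i \sum_j (X : 'M[R]_n) i j ^+ 2.
  rewrite /innermx /mxtrace; apply: eq_bigr => i _; rewrite mxE.
  by apply: eq_bigr => j _; rewrite expr2 -{2}(symmx_tr X) mxE.
have sq_ge0 i j : 0 <= (X : 'M[R]_n) i j ^+ 2 by exact: sqr_ge0.
move=> X0; apply: val_inj; apply/matrixP => i j; rewrite /= [RHS]mxE.
have /(_ i isT) := psumr_eq0P (fun i _ => sumr_ge0 _ (fun j _ => sq_ge0 i j)) X0.
move=> /(psumr_eq0P (fun j _ => sq_ge0 i j))/(_ j isT)/eqP.
by rewrite sqrf_eq0 => /eqP.
Qed.

Definition psd (X : symmx) : Prop :=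
  forall v : 'cV[R]_n, 0 <= (v^T *m X *m v) 0 0.

Definition pd (X : symmx) : Prop :=
  forall v : 'cV[R]_n, v != 0 -> 0 < (v^T *m X *m v) 0 0.

End SymmetricMatrices.

Definition innercv (R : realType) (m : nat) (u v : 'cV[R]_m) : R :=
  (u^T *m v) 0 0.

Lemma innercv_sumr (R : realType) (m : nat) (y : 'cV[R]_m) (I : Type) (r : seq I)
    (F : I -> 'cV[R]_m) :
  innercv y (\sum_(i <- r) F i) = \sum_(i <- r) innercv y (F i).
Proof. by rewrite /innercv mulmx_sumr summxE. Qed.

Section Adjoint.
Context (R : realType) (n m : nat) (A : {linear symmx R n -> 'cV[R]_m}).

(* The matrix below is already symmetric; [sympart] only equips it with the
   type of symmetric matrices. See [adjointP] and [adjoint_unique]. *)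
Definition adjoint (y : 'cV[R]_m) : symmx R n :=
  sympart (\matrix_(i, j) innercv y (A (sympart (delta_mx i j)))).

Lemma adjointP (y : 'cV[R]_m) (X : symmx R n) :
  innermx (adjoint y) X = innercv y (A X).
Proof.
rewrite innermx_sympart -[in RHS](symmxK X) [X in sympart X]matrix_sum_delta.
rewrite !linear_sum /= innercv_sumr /mxtrace.
apply: eq_bigr => i _; rewrite !linear_sum /= innercv_sumr mxE.
apply: eq_bigr => j _; rewrite !linearZ /= /innercv -scalemxAr !mxE.
by rewrite mulrC -[in LHS](symmx_tr X) mxE.
Qed.

Lemma adjoint_unique (y : 'cV[R]_m) (Z : symmx R n) :
  (forall X, innermx Z X = innercv y (A X)) -> Z = adjoint y.
Proof.
move=> hZ; apply/subr0_eq/innermx_definite.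
have -> X : innermx (Z - adjoint y) X = innermx Z X - innermx (adjoint y) X.
  by rewrite /innermx /= mulmxBl linearB.
by rewrite adjointP hZ subrr.
Qed.

End Adjoint.

Section Gauge.
Context (R : realType) (n : nat) (C : symmx R n).
Local Open Scope ereal_scope.

Definition gauge (X : symmx R n) : \bar R :=
  if `[< psd X >] then (innermx C X)%:E else +oo.

Definition gauge_polar (Z : symmx R n) : \bar R :=
  ereal_inf [set mu%:E | mu in [set mu : R | (0 <= mu)%R /\
                                             psd (mu *: C - Z)%R]].

End Gauge.

Section Optimization.
Context (T : Type).

Definition minimizer d (V : porderType d) (f : T -> V) (D : set T) (x : T) :=
  D x /\ forall z, D z -> (f x <= f z)%O.

Definition maximizer d (V : porderType d) (f : T -> V) (D : set T) (x : T) :=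
  D x /\ forall z, D z -> (f z <= f x)%O.

Definition min_value (R : realType) (f : T -> \bar R) (D : set T) : \bar R :=
  ereal_inf (f @` D).

End Optimization.

(* Main.v *)
(* Let p be the primal optimal value; b <> 0 and C > 0 give p > 0. The primal
   and dual optimal values agree: since C > 0, the image of the psd cone under
   X |-> (A X, <C, X>) is closed, so if the dual value d were below p, the
   point (b, d) could be separated from this image by its nearest point, and
   the separating functional would yield a dual feasible y with b^T y > d.
   Hence z = y / p, for y a dual solution, satisfies b^T z >= 1, and
   C / p - A^T z >= 0 shows that the polar gauge of A^T z is at most 1 / p.
   Conversely, pairing mu C - A^T u >= 0 with a primal solution gives
   mu p >= b^T u >= 1. *)
From HB Require Import structures.
Require Import Defs.
From mathcomp Require Import all_boot all_order all_algebra.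
From mathcomp Require Import all_classical all_reals ereal.
From mathcomp Require Import topology normedtype derive.
From mathcomp Require Import ring lra.
Set Implicit Arguments.
Unset Strict Implicit.
Unset Printing Implicit Defensive.
Import Order.TTheory GRing.Theory Num.Theory.
Local Open Scope classical_set_scope.
Local Open Scope ring_scope.

(** * Bilinearity and definiteness of the two inner products *)

Section InnerProducts.
Context (R : realType).

Lemma innermx_linear n (X : symmx R n) : scalar (innermx X).
Proof. by move=> a Y Z; rewrite /innermx /= linearP linearP. Qed.

HB.instance Definition _ n (X : symmx R n) := GRing.isLinear.Build R
  (symmx R n) R *%R (innermx X) (innermx_linear X).

Lemma innermxC n (X Y : symmx R n) : innermx X Y = innermx Y X.
Proof. exact: mxtrace_mulC. Qed.

Lemma innercv_linear m (u : 'cV[R]_m) : scalar (innercv u).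
Proof. by move=> a v w; rewrite /innercv linearP !mxE. Qed.

HB.instance Definition _ m (u : 'cV[R]_m) := GRing.isLinear.Build R
  'cV[R]_m R *%R (innercv u) (innercv_linear u).

Lemma innercvC m (u v : 'cV[R]_m) : innercv u v = innercv v u.
Proof. by rewrite /innercv -[in LHS](trmxK v) -trmx_mul mxE. Qed.

Lemma innercv_self m (u : 'cV[R]_m) : innercv u u = \sum_i u i 0 ^+ 2.
Proof. by rewrite /innercv mxE; apply: eq_bigr => i _; rewrite mxE expr2. Qed.

Lemma innercv_sqrD m (u v : 'cV[R]_m) t :
  innercv (u + t *: v) (u + t *: v) =
  innercv u u + 2 * t * innercv u v + t ^+ 2 * innercv v v.
Proof.
rewrite linearD linearZ /= (innercvC _ u) (innercvC _ v).
by rewrite !linearD !linearZ /= (innercvC v u); ring.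
Qed.

Lemma innercv_ge0 m (u : 'cV[R]_m) : 0 <= innercv u u.
Proof. by rewrite innercv_self sumr_ge0// => i _; exact: sqr_ge0. Qed.

Lemma innercv_eq0 m (u : 'cV[R]_m) : innercv u u = 0 -> u = 0.
Proof.
rewrite innercv_self => /(psumr_eq0P (fun i _ => sqr_ge0 _)) u0.
apply/colP => i; rewrite mxE; apply/eqP; rewrite -sqrf_eq0.
by rewrite u0.
Qed.

Lemma innercv_col m k (u v : 'cV[R]_m) (s t : 'cV[R]_k) :
  innercv (col_mx u s) (col_mx v t) = innercv u v + innercv s t.
Proof. by rewrite /innercv tr_col_mx mul_row_col mxE. Qed.

End InnerProducts.

(** * The psd cone: Schur complements, self-duality, entry bounds *)

Section PositiveSemidefinite.
Context (R : realType) (n : nat).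
Implicit Types (S X Y C : symmx R n) (u v : 'cV[R]_n).

(** [u *m u^T] is already symmetric, so [sympart] only supplies the type. Pairing with it evaluates
    the quadratic form at [u], which makes [psd] a family of linear inequalities. *)
Definition outer u : symmx R n := sympart (u *m u^T).

Lemma outerE u : (outer u : 'M[R]_n) = u *m u^T.
Proof.
rewrite /= trmx_mul trmxK -mulr2n -scaler_nat scalerA.
by rewrite mulVf ?scale1r// pnatr_eq0.
Qed.

Lemma innermx_outer u X : innermx (outer u) X = (u^T *m X *m u) 0 0.
Proof. by rewrite /innermx outerE -mulmxA mxtrace_mulC -trace_mx11. Qed.

Lemma psdP X : psd X <-> forall u, 0 <= innermx (outer u) X.
Proof. by split=> h u; have := h u; rewrite innermx_outer. Qed.

Lemma innermx_outer2 u v : innermx (outer u) (outer v) = innercv u v ^+ 2.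
Proof.
rewrite innermx_outer outerE !mulmxA -mulmxA mxE big_ord1 expr2.
by congr (_ * _); exact: innercvC.
Qed.

Lemma psd_outer u : psd (outer u).
Proof. by apply/psdP => v; rewrite innermx_outer2 sqr_ge0. Qed.

Lemma psdD X Y : psd X -> psd Y -> psd (X + Y).
Proof.
move=> /psdP hX /psdP hY; apply/psdP => u; rewrite linearD.
exact: (addr_ge0 (hX u) (hY u)).
Qed.

Lemma psdZ (a : R) X : 0 <= a -> psd X -> psd (a *: X).
Proof.
move=> a0 /psdP hX; apply/psdP => u; rewrite linearZ.
exact: (mulr_ge0 a0 (hX u)).
Qed.

Lemma psd0 : psd (0 : symmx R n).
Proof. by apply/psdP => u; rewrite linear0. Qed.

Lemma pd_psd X : pd X -> psd X.
Proof.
move=> X_pd v; have [->|/X_pd/ltW//] := eqVneq v 0.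
by rewrite mulmx0 mxE.
Qed.

Lemma bilinear_sym X u v : innercv u (X *m v) = innercv v (X *m u).
Proof. by rewrite innercvC /innercv trmx_mul symmx_tr mulmxA. Qed.

Lemma psd_ge0 X u : psd X -> 0 <= innercv u (X *m u).
Proof. by move=> /(_ u); rewrite /innercv mulmxA. Qed.

(** The form is nonnegative on all combinations of [u] and [v]; as it may be degenerate, the case
    where it vanishes at [v] is treated apart. *)
Lemma psd_Cauchy_Schwarz X u v : psd X ->
  innercv u (X *m v) ^+ 2 <= innercv u (X *m u) * innercv v (X *m v).
Proof.
move=> X_psd.
have expand s t : 0 <= s ^+ 2 * innercv u (X *m u)
    + 2 * s * t * innercv u (X *m v) + t ^+ 2 * innercv v (X *m v).
  have := psd_ge0 (s *: u + t *: v) X_psd.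
  rewrite mulmxDr -!scalemxAr [innercv _ (_ + _)]linearD !linearZ /=.
  rewrite ![innercv (_ + _) _]innercvC !linearD !linearZ /=.
  rewrite ![innercv (X *m _) _]innercvC (bilinear_sym X v u).
  by congr (_ <= _); ring.
set a := innercv u _ in expand *; set c := innercv v _ in expand *.
set b := innercv u _ in expand *.
have c_ge0 : 0 <= c by exact: psd_ge0.
have [c0|c_neq0] := eqVneq c 0; last first.
  have c_gt0 : 0 < c by rewrite lt_neqAle eq_sym c_neq0.
  have := expand c (- b).
  have -> : c ^+ 2 * a + 2 * c * - b * b + (- b) ^+ 2 * c =
      c * (a * c - b ^+ 2).
    by ring.
  by rewrite pmulr_rge0// subr_ge0.
rewrite c0 mulr0; rewrite c0 in expand.
have [->|b_neq0] := eqVneq b 0; first by rewrite expr0n.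
(* With [c = 0] the expansion is affine in [t]; this [t] makes it equal to -1. *)
have := expand 1 (- (a + 1) / (2 * b)).
have -> : 1 ^+ 2 * a + 2 * 1 * (- (a + 1) / (2 * b)) * b +
  (- (a + 1) / (2 * b)) ^+ 2 * 0 = -1.
  by field.
by rewrite oppr_ge0 ler10.
Qed.

Let e_ i : 'cV[R]_n := delta_mx i 0.

Lemma innercv_delta i u : innercv (e_ i) u = u i 0.
Proof. by rewrite /innercv trmx_delta -rowE mxE. Qed.

Lemma mulmx_delta X i j : (X *m e_ j) i 0 = X i j.
Proof. by rewrite -colE mxE. Qed.

Lemma psd_diag_ge0 X i : psd X -> 0 <= X i i.
Proof. by move=> /(psd_ge0 (e_ i)); rewrite innercv_delta mulmx_delta. Qed.

Lemma psd_entry X i j : psd X -> X i j ^+ 2 <= X i i * X j j.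
Proof.
move=> /(psd_Cauchy_Schwarz (e_ i) (e_ j)).
by rewrite !innercv_delta !mulmx_delta.
Qed.

(** Schur complement of the entry [X i i], kept at full size: for [X i i != 0], row and column [i]
    become zero instead of being removed. *)
Definition schur X i : symmx R n := X - (X i i)^-1 *: outer (X *m e_ i).

Lemma schur_psd X i : psd X -> X i i != 0 -> psd (schur X i).
Proof.
move=> X_psd Xii u; have Xii_gt0 : 0 < X i i.
  by rewrite lt_neqAle eq_sym Xii psd_diag_ge0.
have -> : (u^T *m schur X i *m u) 0 0 =
    innercv u (X *m u) - (X i i)^-1 * innercv u (X *m e_ i) ^+ 2.
  rewrite -innermx_outer linearB linearZ /= !innermx_outer; congr (_ - _ * _).
    by rewrite /innercv mulmxA.
  by rewrite -innermx_outer innermx_outer2.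
rewrite subr_ge0 mulrC ler_pdivrMr// mulrC.
have := psd_Cauchy_Schwarz u (e_ i) X_psd.
by rewrite innercv_delta mulmx_delta mulrC.
Qed.

Lemma schur_diag X i j :
  schur X i j j = X j j - (X i i)^-1 * X j i ^+ 2.
Proof.
have -> : (schur X i : 'M_n) =
  (X : 'M_n) - (X i i)^-1 *: (outer (X *m e_ i) : 'M_n) by [].
have subE (M N : 'M[R]_n) a : (M - a *: N) j j = M j j - a * N j j.
  by rewrite !mxE.
have sqrE u : (u *m u^T) j j = u j 0 ^+ 2.
  by rewrite mxE big_ord1 mxE expr2.
by rewrite subE outerE sqrE mulmx_delta.
Qed.

Lemma psd_diag0 X : psd X -> (forall i, X i i = 0) -> X = 0.
Proof.
move=> X_psd X0; apply/val_inj/matrixP => i j; rewrite mxE; apply/eqP.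
have := psd_entry i j X_psd.
by rewrite X0 mul0r -sqrf_eq0 eq_le sqr_ge0 andbT.
Qed.

(* Induction on the number of nonzero diagonal entries: passing to a Schur
   complement subtracts a rank-one matrix and kills one of them. *)
Lemma psd_innermx_ge0 S X : psd S -> psd X -> 0 <= innermx S X.
Proof.
move=> S_psd; have [k] := ubnP #|[pred i | X i i != 0]|.
elim: k X => // k IHk X; rewrite ltnS => Xk X_psd.
have [X0|] := boolP [forall i, X i i == 0].
  by rewrite (psd_diag0 X_psd) ?linear0// => i; exact/eqP/(forallP X0).
rewrite negb_forall => /existsP[i Xii].
have -> : X = schur X i + (X i i)^-1 *: outer (X *m e_ i) by rewrite subrK.
rewrite linearD linearZ /=; apply: addr_ge0.
  apply: IHk; last exact: schur_psd.
  rewrite (leq_trans _ Xk)// proper_card//; apply/properP; split.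
    apply/fintype.subsetP => j; rewrite !inE schur_diag.
    apply: contra_neq => Xjj.
    (* Zero diagonal entries stay zero: [X j j = 0] forces [X j i = 0]. *)
    have := psd_entry j i X_psd; rewrite Xjj mul0r => Xji.
    suff -> : X j i ^+ 2 = 0 by rewrite mulr0 subr0.
    by apply/eqP; rewrite eq_le Xji sqr_ge0.
  exists i; rewrite !inE// negbK schur_diag expr2 mulrA mulVf// mul1r.
  by rewrite subrr.
apply: mulr_ge0; first by rewrite invr_ge0 psd_diag_ge0.
by rewrite innermxC; exact: (psdP _).1.
Qed.

Lemma pd_unitmx C : pd C -> (C : 'M[R]_n) \in unitmx.
Proof.
move=> C_pd; rewrite -row_free_unit -kermx_eq0; apply/rowV0P => v.
move=> /sub_kermxP vC0; apply/eqP/negP => v0.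
have /C_pd : v^T != 0 by rewrite trmx_eq0; apply/negP.
by rewrite trmxK vC0 mul0mx mxE ltxx.
Qed.

(* Cauchy-Schwarz for the form [C] against [C^-1 e_i] gives
   [v_i ^ 2 <= (C^-1)_ii * (v^T C v)]. *)
Lemma pd_diag_bound C i : pd C ->
  exists2 k : R, 0 <= k & forall X, psd X -> X i i <= k * innermx C X.
Proof.
move=> C_pd; have C_psd := pd_psd C_pd; set u := invmx C *m e_ i.
have Cu : C *m u = e_ i by rewrite mulKVmx// pd_unitmx.
exists (innercv u (C *m u)) => [|X X_psd]; first exact: psd_ge0.
set k := innercv _ _.
have M_psd : psd (k *: C - outer (e_ i)).
  apply/psdP => v; rewrite linearB linearZ /= !innermx_outer.
  have -> : (v^T *m outer (e_ i) *m v) 0 0 = innercv v (C *m u) ^+ 2.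
    by rewrite Cu -innermx_outer innermx_outer2.
  by rewrite subr_ge0 mulrC -mulmxA; exact: psd_Cauchy_Schwarz.
(* Pairing [X] with [k *: C - outer (e_ i)] yields the bound on [X i i]. *)
have := psd_innermx_ge0 X_psd M_psd; rewrite linearB linearZ /= subr_ge0.
rewrite innermxC (innermxC X C) innermx_outer -mulmxA.
by rewrite -/(innercv _ _) innercv_delta mulmx_delta.
Qed.

(** Diagonal bounds control all entries through [psd_entry]. Hence bounding [innermx C X] bounds [X]
    on the psd cone. *)
Lemma pd_entry_bound C : pd C -> exists2 k : R, 0 <= k &
  forall X, psd X -> forall i j, `|X i j| <= k * innermx C X.
Proof.
move=> C_pd; have C_psd := pd_psd C_pd.
have [k k_ge0 hk] : exists2 k : 'I_n -> R, (forall i, 0 <= k i) &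
    forall i X, psd X -> X i i <= k i * innermx C X.
  have /choice[k hk] : forall i, exists k : R, 0 <= k /\
      forall X, psd X -> X i i <= k * innermx C X.
    by move=> i; have [k] := pd_diag_bound i C_pd; exists k.
  by exists k => i; have [] := hk i.
exists (\sum_i k i) => [|X X_psd i j]; first exact: sumr_ge0.
have CX_ge0 := psd_innermx_ge0 C_psd X_psd.
have diag l : X l l <= (\sum_i k i) * innermx C X.
  apply: le_trans (hk l X X_psd) _; apply: ler_wpM2r => //.
  by rewrite (bigD1 l)//= lerDl sumr_ge0.
have B_ge0 : 0 <= (\sum_i k i) * innermx C X
  by apply: mulr_ge0 => //; exact: sumr_ge0.
rewrite -ler_sqr ?nnegrE ?normr_ge0// real_normK ?num_real//.
rewrite (le_trans (psd_entry i j X_psd))// expr2.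
by apply: ler_pM; rewrite ?psd_diag_ge0.
Qed.

End PositiveSemidefinite.

Import numFieldNormedType.Exports.

(** * Compactness and nearest points in a linear image of the psd cone *)

Section NearestPoint.
Context (R : realType).

Lemma continuous_big_sum (T : topologicalType) (I : Type) (r : seq I)
    (F : I -> T -> R) :
  (forall i, continuous (F i)) -> continuous (fun x => \sum_(i <- r) F i x).
Proof.
move=> F_cont; elim: r => [|i r IHr].
  by under eq_fun do rewrite big_nil; exact: cst_continuous.
under eq_fun do rewrite big_cons.
by move=> x; exact: (continuousD (F_cont i x) (IHr x)).
Qed.

Lemma scalar_continuous p (f : {scalar 'rV[R]_p}) :
  continuous (f : 'rV[R]_p -> R).
Proof.
have -> : (f : 'rV[R]_p -> R) = fun v => \sum_j v 0 j * f (delta_mx 0 j).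
  apply/funext => v; rewrite [in LHS](row_sum_delta v) linear_sum.
  by apply: eq_bigr => j _; rewrite linearZ.
apply: continuous_big_sum => j v.
apply: (@continuousM R 'rV[R]_p (fun v => v 0 j) (cst (f (delta_mx 0 j)))).
  exact: coord_continuous.
exact: cst_continuous.
Qed.

Context (n k : nat) (B : {linear symmx R n -> 'cV[R]_k}).

(** Flattening matrices to vectors gives a product of segments, cut by the closed half-spaces
    [0 <= innermx (outer u) _]. *)
Lemma psd_box_compact (M : R) :
  compact [set v : 'rV[R]_(n * n) | (forall l, v 0 l \in `[- M, M]) /\
                                    psd (sympart (vec_mx v))].
Proof.
have psd_closed : closed [set v : 'rV[R]_(n * n) | psd (sympart (vec_mx v))].
  have -> : [set v : 'rV[R]_(n * n) | psd (sympart (vec_mx v))] =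
      \bigcap_(u in [set: 'cV[R]_n])
        ((fun v => innermx (outer u) (sympart (vec_mx v))) @^-1`
           [set x | 0 <= x]).
    apply/seteqP; split=> v /=; first by move=> /psdP v_psd u _; exact: v_psd.
    by move=> v_psd; apply/psdP => u; exact: v_psd.
  apply: closed_bigI => u _; apply: preimage_closed; last exact: closed_ge.
  pose l : {scalar 'rV[R]_(n * n)} :=
    innermx (outer u) \o @sympart R n \o vec_mx.
  move=> v _; exact: (@scalar_continuous _ l v).
apply: compact_closedI psd_closed.
exact: (rV_compact (fun=> @segment_compact _ (- M) M)).
Qed.

(** The competitor [X = 0] has squared distance [innercv w w], so only points at most that far
    matter; by hypothesis they lie in a compact box. *)
Lemma nearest_point (w : 'cV[R]_k) (M : R) :
    (forall X, psd X -> innercv (B X - w) (B X - w) <= innercv w w ->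
       forall i j, `|X i j| <= M) ->
  exists2 X, psd X & forall Y, psd Y ->
    innercv (B X - w) (B X - w) <= innercv (B Y - w) (B Y - w).
Proof.
move=> bounded.
pose S (v : 'rV[R]_(n * n)) : symmx R n := sympart (vec_mx v).
pose q X := innercv (B X - w) (B X - w).
have SK (X : symmx R n) : S (mxvec X) = X by rewrite /S mxvecK symmxK.
have q_cont : continuous (q \o S : 'rV[R]_(n * n) -> R).
  have -> : q \o S = fun v => \sum_i (B (S v) i 0 - w i 0) ^+ 2.
    apply/funext => v; rewrite /= /q innercv_self.
    by apply: eq_bigr => i _; rewrite !mxE.
  apply: continuous_big_sum => i v.
  pose l : {scalar 'rV[R]_(n * n)} :=
    innercv (delta_mx i 0) \o B \o @sympart R n \o vec_mx.
  have l_cont : {for v, continuous (fun v => B (S v) i 0 - w i 0)}.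
    have -> : (fun v => B (S v) i 0 - w i 0) = fun v => l v - w i 0.
      by apply/funext => v'; rewrite /l /= innercv_delta.
    apply: continuousB; [exact: scalar_continuous|exact: cst_continuous].
  exact: (continuousM l_cont l_cont).
pose K := [set v : 'rV[R]_(n * n) |
  (forall l, v 0 l \in `[- M, M]) /\ psd (S v)].
have small X : psd X -> q X <= innercv w w -> K (mxvec X).
  move=> X_psd qX; split; last by rewrite SK.
  move=> l; case/mxvec_indexP: l => i j; rewrite mxvecE in_itv /= -ler_norml.
  exact: bounded.
have q0 : q 0 = innercv w w.
  rewrite /q linear0 sub0r !innercv_self.
  by apply: eq_bigr => i _; rewrite mxE sqrrN.
have [|||v] := @compact_EVT_min _ R (q \o S) K.
- by exists (mxvec (0 : symmx R n)); apply: small; [exact: psd0|rewrite q0].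
- exact: psd_box_compact.
- exact: continuous_subspaceT.
rewrite inE => -[_ Sv_psd] v_min; exists (S v) => // Y Y_psd.
have le_small X : psd X -> q X <= innercv w w -> q (S v) <= q X.
  move=> X_psd qX; rewrite -[in leRHS](SK X).
  by apply: v_min; rewrite inE; exact: small.
have [qY|/ltW qY] := leP (q Y) (innercv w w); first exact: le_small.
by apply: le_trans qY; rewrite -q0 le_small ?q0//; exact: psd0.
Qed.

End NearestPoint.

(** * Separation from the image of the cone, and strong duality *)

Section Duality.
Context (R : realType).

Lemma first_order_ge0 (a c : R) : 0 <= c ->
  (forall t, 0 <= t <= 1 -> 0 <= 2 * t * a + t ^+ 2 * c) -> 0 <= a.
Proof.
move=> c_ge0 ineq; rewrite leNgt; apply/negP => a_lt0.
(* The denominator exceeds both [- a] and [c], so [t < 1] and [t * c < - a], whence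
   [2 * a + t * c < 0]. *)
pose t := - a / (c + 1 - a).
have den_gt0 : 0 < c + 1 - a by lra.
have tden : t * (c + 1 - a) = - a by rewrite /t divfK// gt_eqF.
have t_gt0 : 0 < t by rewrite /t divr_gt0// oppr_gt0.
have t_le1 : t <= 1 by rewrite /t ler_pdivrMr// mul1r; lra.
have := ineq t; rewrite (ltW t_gt0) t_le1 => /(_ isT).
have -> : 2 * t * a + t ^+ 2 * c = t * (2 * a + t * c) by ring.
rewrite pmulr_rge0// => ge0; nra.
Qed.

(** The residual [r] at a nearest point separates: the squared distance has nonnegative one-sided
    derivative along every direction staying in the cone. *)
Lemma psd_image_separation n k (B : {linear symmx R n -> 'cV[R]_k})
    (w : 'cV[R]_k) (M : R) :
    (forall X, psd X -> innercv (B X - w) (B X - w) <= innercv w w ->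
       forall i j, `|X i j| <= M) ->
    (forall X, psd X -> B X != w) ->
  exists2 r, innercv r w < 0 & forall X, psd X -> 0 <= innercv r (B X).
Proof.
move=> bounded not_in; have [X X_psd X_min] := nearest_point bounded.
set r := B X - w in X_min *.
have r_gt0 : 0 < innercv r r.
  rewrite lt_neqAle innercv_ge0 andbT eq_sym; apply: contraNN (not_in _ X_psd).
  by move=> /eqP/innercv_eq0/eqP; rewrite subr_eq0.
have feasible_dir D : (forall t, 0 <= t <= 1 -> psd (X + t *: D)) ->
    0 <= innercv r (B D).
  move=> D_psd; apply: (first_order_ge0 (innercv_ge0 (B D))) => t /D_psd/X_min.
  have -> : B (X + t *: D) - w = r + t *: B D.
    by rewrite linearD linearZ /= addrAC.
  by rewrite innercv_sqrD -addrA lerDl.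
exists r => [|D D_psd]; last first.
  by apply: feasible_dir => t /andP[t_ge0 _]; apply: psdD => //; exact: psdZ.
(* Shrinking [X] towards 0 stays in the cone, so [innercv r (B X) <= 0]; subtracting
   [innercv r r > 0] gives the strict sign at [w]. *)
have : 0 <= innercv r (B (- X)).
  apply: feasible_dir => t /andP[_ t_le1].
  have -> : X + t *: - X = (1 - t) *: X by rewrite scalerN scalerBl scale1r.
  by apply: psdZ => //; rewrite subr_ge0.
have -> : w = B X - r by rewrite /r opprB addrC subrK.
by rewrite !linearN linearB /= oppr_ge0 subr_lt0 => /le_lt_trans; exact.
Qed.

Context (n m : nat) (C : symmx R n) (A : {linear symmx R n -> 'cV[R]_m}).

(** [(b, d)] lies in the image of the psd cone exactly when some primal feasible point has value
    [d]. *)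
Definition value_map (X : symmx R n) : 'cV[R]_(m + 1) :=
  col_mx (A X) (innermx C X)%:M.

Lemma value_map_linear : linear value_map.
Proof.
move=> a X Y; rewrite /value_map !linearP /=.
by rewrite scale_col_mx add_col_mx raddfD /= scale_scalar_mx.
Qed.

HB.instance Definition _ := GRing.isLinear.Build R
  (symmx R n) 'cV[R]_(m + 1) *:%R value_map value_map_linear.

Lemma innercv_scalar (s t : R) :
  innercv (s%:M : 'cV[R]_1) (t%:M : 'cV[R]_1) = s * t.
Proof. by rewrite /innercv tr_scalar_mx -scalar_mxM mxE eqxx mulr1n. Qed.

Lemma value_map_bounded (b : 'cV[R]_m) (d : R) : pd C ->
  exists M, forall X, psd X ->
    let w := col_mx b d%:M in
    innercv (value_map X - w) (value_map X - w) <= innercv w w ->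
    forall i j, `|X i j| <= M.
Proof.
move=> /pd_entry_bound[k k_ge0 hk].
set w := col_mx b d%:M.
exists (k * (d + innercv w w + 1)) => X X_psd /= Xw i j.
apply: le_trans (hk X X_psd i j) _; apply: ler_wpM2l => //.
move: Xw; rewrite {1 2}/w /value_map opp_col_mx add_col_mx innercv_col.
rewrite -raddfN -raddfD innercv_scalar /=.
have := innercv_ge0 (A X - b); set e := innercv _ _; set c := innermx C X.
set W := innercv w w => e_ge0 cW.
(* This square gives [c - d <= (c - d) ^+ 2 + 1/4 <= W + 1/4]. *)
have := sqr_ge0 (c - d - 2^-1). nra.
Qed.

(* Separating the point [(b, d)] from the image of the psd cone under
   [X |-> (A X, <C, X>)] gives [(z, t)]; testing it on the primal solution
   forces [t > 0], and then [- z / t] is dual feasible with value above [d]. *)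
Lemma strong_duality (b : 'cV[R]_m) (X : symmx R n) (y : 'cV[R]_m) : pd C ->
    minimizer (innermx C) [set X | A X = b /\ psd X] X ->
    maximizer (innercv b) [set y | psd (C - adjoint A y)] y ->
  innermx C X <= innercv b y.
Proof.
move=> C_pd [[AX X_psd] X_min] [_ y_max]; rewrite leNgt; apply/negP => lt_d.
set d := innercv b y in lt_d y_max.
have [M bounded] := value_map_bounded b d C_pd.
have [Y Y_psd|r] := psd_image_separation bounded.
  apply/eqP => /eq_col_mx[AY CY].
  have CYd : innermx C Y = d.
    by have := congr1 (fun N : 'M[R]_1 => N 0 0) CY; rewrite !mxE !mulr1n.
  by have := X_min Y (conj AY Y_psd); rewrite CYd leNgt lt_d.
pose z := usubmx r; pose t := dsubmx r 0 0.
have -> : r = col_mx z t%:M by rewrite -mx11_scalar vsubmxK.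
rewrite innercv_col innercv_scalar => rw_lt0 r_ge0.
have zt_ge0 H : psd H -> 0 <= innercv z (A H) + t * innermx C H.
  by move=> /r_ge0; rewrite /= /value_map innercv_col innercv_scalar.
have t_gt0 : 0 < t by have := zt_ge0 X X_psd; rewrite AX => ?; nra.
have := y_max (- t^-1 *: z); rewrite leNgt => /(_ _)/negP; apply.
  (* At [outer u], [zt_ge0] is [t] times the quadratic form of the dual slack at [u]. *)
  apply/psdP => u; have := zt_ge0 _ (psd_outer u).
  rewrite linearB /= [innermx _ (adjoint _ _)]innermxC adjointP.
  rewrite (innercvC (_ *: _)) linearZ /= (innercvC _ z) innermxC => ge0.
  rewrite mulNr opprK -(pmulr_rge0 _ t_gt0) mulrDr mulrA divff ?gt_eqF// mul1r.
  by rewrite addrC.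
rewrite linearZ /= innercvC mulNr -mulrN mulrC ltr_pdivlMr//; lra.
Qed.

(** A zero value would force [X = 0] by [pd_entry_bound]. *)
Lemma primal_value_gt0 (X : symmx R n) : pd C -> psd X -> A X != 0 ->
  0 < innermx C X.
Proof.
move=> C_pd X_psd; have C_psd := pd_psd C_pd.
rewrite lt_neqAle psd_innermx_ge0 // andbT.
apply: contraNN => /eqP CX0; have [k _ hk] := pd_entry_bound C_pd.
suff -> : X = 0 by rewrite linear0.
apply/val_inj/matrixP => i j; rewrite mxE; apply/eqP.
by rewrite -normr_le0 (le_trans (hk X X_psd i j))// -CX0 mulr0.
Qed.

End Duality.

(** * Attained infima and gauge duality *)

Lemma min_value_minimizer (T : Type) (R : realType) (f : T -> \bar R)
    (D : set T) (x : T) : minimizer f D x -> min_value f D = f x.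
Proof.
move=> [Dx x_min]; apply/eqP; rewrite eq_le; apply/andP; split.
  by apply: ereal_inf_lbound; exists x.
by apply: le_ereal_inf_tmp => _ [z Dz <-]; exact: x_min.
Qed.

Theorem theorem4p2 (R : realType) (m n : nat)
    (C : symmx R n) (b : 'cV[R]_m) (A : {linear symmx R n -> 'cV[R]_m})
    (primal_sol : exists X : symmx R n,
       minimizer (innermx C) [set X | A X = b /\ psd X] X)
    (dual_sol : exists y : 'cV[R]_m,
       maximizer (innercv b) [set y | psd (C - adjoint A y)] y)
    (C_pd : pd C) (b_neq0 : b != 0)
    (slater : exists X : symmx R n, pd X /\ A X = b) :
  [/\ exists X : symmx R n,
        minimizer (gauge C) [set X | A X = b] X,
      exists y : 'cV[R]_m,
        minimizer (fun y => gauge_polar C (adjoint A y))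
                  [set y | 1 <= innercv b y] y
    & (min_value (gauge C) [set X | A X = b] *
       min_value (fun y => gauge_polar C (adjoint A y))
                 [set y | (1 <= innercv b y)%R] = 1)%E].
Proof.
have [X X_opt] := primal_sol; have [y y_opt] := dual_sol.
have p_le := strong_duality C_pd X_opt y_opt.
have [[AX X_psd] X_min] := X_opt; have [y_psd _] := y_opt.
set p := innermx C X in p_le.
have p_gt0 : 0 < p by apply: (primal_value_gt0 (A := A)); rewrite ?AX.
have gaugeX : gauge C X = p%:E by rewrite /gauge asboolT.
have X_gauge : minimizer (gauge C) [set X | A X = b] X.
  split=> // Z AZ; rewrite gaugeX /gauge; case: asboolP => [Z_psd|_].
    by rewrite lee_fin; exact: X_min.
  by rewrite leey.
have weak z : 1 <= innercv b z -> (p^-1%:E <= gauge_polar C (adjoint A z))%E.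
  move=> bz; apply: le_ereal_inf_tmp => _ [mu [mu_ge0 mu_psd] <-].
  rewrite lee_fin -[leLHS]mul1r ler_pdivrMr// (le_trans bz)//.
  have := psd_innermx_ge0 X_psd mu_psd.
  rewrite linearB linearZ /= subr_ge0 innermxC adjointP AX innercvC.
  by rewrite (innermxC X C).
pose z := p^-1 *: y.
have bz : 1 <= innercv b z.
  by rewrite linearZ /= mulrC ler_pdivlMr// mul1r.
have gaugez : gauge_polar C (adjoint A z) = p^-1%:E.
  apply/eqP; rewrite eq_le weak// andbT; apply: ereal_inf_lbound.
  exists p^-1 => //; split; first by rewrite invr_ge0 ltW.
  (* The slack at [z] is the dual slack at [y] scaled by [p^-1]; homogeneity of the adjoint follows
     from its uniqueness. *)
  have <- : p^-1 *: (C - adjoint A y) = p^-1 *: C - adjoint A z.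
    rewrite scalerBr; congr (_ - _); apply: adjoint_unique => H.
    rewrite innermxC linearZ /= innermxC adjointP.
    by rewrite (innercvC z) linearZ /= innercvC.
  by apply: psdZ y_psd; rewrite invr_ge0 ltW.
have z_polar : minimizer (fun y => gauge_polar C (adjoint A y))
    [set y | 1 <= innercv b y] z.
  by split=> // u bu; rewrite gaugez; exact: weak.
split; [by exists X|by exists z|].
rewrite (min_value_minimizer X_gauge) (min_value_minimizer z_polar).
by rewrite gaugeX gaugez -EFinM divff ?gt_eqF.
Qed.
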